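(* Let $\psi: T \to \mathbb{C}$ be a function and $\varphi: T \to T$ a self-map with finite range (i.e. $\varphi(T)$ is a finite set). Then $W_{\psi,\varphi}$ is bounded on $L_\mu^0$ if and only if $$\lim_{|v| \to \infty} \frac{\mu(v)}{\mu(\varphi(v))}|\psi(v)| = 0.$$ Moreover, in this case the operator norm of $W_{\psi,\varphi}$ on $L_\mu^0$ satisfies $$\|W_{\psi,\varphi}\| = \sup_{v \in T} \frac{\mu(v)}{\mu(\varphi(v))}|\psi(v)|.$$
   Context: $(T,\mathrm{d})$ is a metric space with a distinguished point $o$ (the root); the length of $v \in T$ is $|v| = \mathrm{d}(o,v)$. $T$ is assumed locally finite (for every $M>0$ the set $\{v \in T : |v| < M\}$ is finite) and unbounded (for every $M>0$ there is $v \in T$ with $|v| \ge M$). $\mu: T \to (0,\infty)$ is an arbitrary positive function (a weight). $L_\mu^\infty$ is the Banach space of functions $f: T \to \mathbb{C}$ with $\|f\|_\mu = \sup_{v \in T} \mu(v)|f(v)| < \infty$, and $L_\mu^0$ is its closed subspace of those $f$ with $\lim_{|v|\to\infty} \mu(v)|f(v)| = 0$. The weighted composition operator is the linear map $W_{\psi,\varphi} f = \psi\,(f\circ\varphi)$; it is bounded on $L_\mu^0$ if it is a bounded operator from $L_\mu^0$ to itself. *)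

(* Defs.v *)
From HB Require Import structures.
From mathcomp Require Import all_boot all_order all_algebra.
From mathcomp Require Import all_classical all_reals all_analysis.
From mathcomp Require Import complex.
Set Implicit Arguments.
Unset Strict Implicit.
Unset Printing Implicit Defensive.
Import Order.TTheory GRing.Theory Num.Theory.
Import numFieldNormedType.Exports.
Import ComplexField.Normc.
Local Open Scope classical_set_scope.
Local Open Scope ring_scope.
Local Open Scope complex_scope.

Section rooted_metric_space.
Context {R : realType} {T : metricType R}.
Implicit Type o : T.

Definition vlength o (v : T) : R := mdist o v.

Definition locally_finite o : Prop :=
  forall M : R, 0 < M -> finite_set [set v | vlength o v < M].

Definition unbounded o : Prop :=
  forall M : R, 0 < M -> exists v, M <= vlength o v.

(* The filter [|v| --> oo]. It involves the length only, not the topology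
   of [T]. *)
Definition at_infinity o : set_system T :=
  filter_from [set M : R | 0 < M] (fun M => [set v | M <= vlength o v]).

Lemma at_infinity_filter o : Filter (at_infinity o).
Proof.
apply: filter_from_filter; first by exists 1 => /=.
move=> M N /= M0 N0; exists (Num.max M N) => /=; first by rewrite lt_max M0.
by move=> v /=; rewrite ge_max => /andP[].
Qed.

Lemma at_infinity_proper o : unbounded o -> ProperFilter (at_infinity o).
Proof.
move=> uT; apply: filter_from_proper; first exact: at_infinity_filter.
by move=> M /uT [v Mv]; exists v.
Qed.

End rooted_metric_space.

#[global] Existing Instance at_infinity_filter.

Section weighted_spaces.
Context {R : realType} {T : metricType R}.
Implicit Types (o : T) (mu : T -> R) (f : T -> R[i]).

(* [normc z : R] is the modulus of [z], whereas MathComp's [`|z|] lives in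
   [R[i]]. The supremum is taken in [\bar R], hence is [+oo] exactly when [f]
   is not in [Linfty mu]. *)
Definition wnorm mu f : \bar R :=
  ereal_sup (range (fun v => (mu v * normc (f v))%:E)).

Definition Linfty mu : set (T -> R[i]) := [set f | (wnorm mu f < +oo)%E].

Definition L0 o mu : set (T -> R[i]) :=
  [set f | Linfty mu f /\ mu v * normc (f v) @[v --> at_infinity o] --> (0 : R)].

(* [A] is defined on all functions; being an operator from [L0] to itself
   includes mapping [L0] into [L0]. *)
Definition bounded_on_L0 o mu (A : (T -> R[i]) -> (T -> R[i])) : Prop :=
  [/\ (forall (c : R[i]) f g, L0 o mu f -> L0 o mu g ->
        A (fun v => c * f v + g v) = (fun v => c * A f v + A g v)),
      (forall f, L0 o mu f -> L0 o mu (A f)) &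
      exists C : R, forall f, L0 o mu f ->
        (wnorm mu (A f) <= C%:E * wnorm mu f)%E].

Definition opnorm_L0 o mu (A : (T -> R[i]) -> (T -> R[i])) : \bar R :=
  ereal_sup [set wnorm mu (A f) | f in
    [set f | L0 o mu f /\ (wnorm mu f <= 1)%E]].

Definition weighted_comp (psi : T -> R[i]) (phi : T -> T) f : T -> R[i] :=
  fun v => psi v * f (phi v).

End weighted_spaces.

(* Main.v *)
(* With r v := mu v / mu (phi v) * |psi v| one has
   mu v |(W f) v| = r v * (mu (phi v) |f (phi v)|), so r bounds W pointwise.
   The function equal to 1/mu on the finite set phi(T) and to 0 elsewhere lies
   in the unit ball of L0, and there this identity reads mu |W f| = r; testing
   W on this single function gives both the necessity of r --> 0 and the lower
   bound on the norm. *)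
Require Import Defs.
From mathcomp Require Import all_boot all_order all_algebra.
From mathcomp Require Import all_classical all_reals all_analysis.
From mathcomp Require Import complex ring.
Import Order.TTheory GRing.Theory Num.Theory.
Import numFieldNormedType.Exports.
Import ComplexField.Normc.
Local Open Scope classical_set_scope.
Local Open Scope ring_scope.
Local Open Scope complex_scope.

Set Implicit Arguments.
Unset Strict Implicit.
Unset Printing Implicit Defensive.

Lemma normc_ge0 (R : rcfType) (z : R[i]) : 0 <= normc z.
Proof. by case: z => a b; exact: sqrtr_ge0. Qed.

Lemma normc_real (R : rcfType) (x : R) : 0 <= x -> normc x%:C = x.
Proof. by move=> x0; rewrite /normc /= expr0n /= addr0 sqrtr_sqr ger0_norm. Qed.

Lemma finite_set_bounded_above (R : realType) (T : Type) (A : set T)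
    (h : T -> R) :
  finite_set A -> exists C : R, forall v, A v -> h v <= C.
Proof.
move=> /(finite_image h)/finite_seqP[s hs].
exists (\big[Num.max/0]_(x <- s) x) => v Av.
have hvs : [set` s] (h v) by rewrite -hs; exists v.
exact: (@le_bigmax_seq _ _ _ _ _ (h v)).
Qed.

Section weighted.
Context {R : realType} {T : metricType R}.
Implicit Types (o v : T) (mu h : T -> R) (f psi : T -> R[i]) (phi : T -> T).

(** Convergence gives [h < 1] outside some ball around [o]; by local finiteness the ball is finite,
    so [h] has a bound there too. Applied to [r], this yields the operator constant. *)
Lemma cvg_at_infinity_bounded o h : locally_finite o ->
  h v @[v --> at_infinity o] --> (0 : R) -> exists C : R, forall v, h v <= C.
Proof.
move=> lfT /cvgr_lt/(_ 1 ltr01)[M /= M0 hM].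
have [C hC] := finite_set_bounded_above h (lfT _ M0).
exists (Num.max 1 C) => v; rewrite le_max.
by have [/hM/= /ltW ->//|/hC ->] := leP M (vlength o v); rewrite orbT.
Qed.

Lemma finite_support_at_infinity o (A : set T) : finite_set A ->
  \forall v \near at_infinity o, ~ A v.
Proof.
move=> /(finite_set_bounded_above (vlength o))[C hC].
(* The radius must be positive, hence the [1], and strictly above every length in [A], hence
   [C + 1]. *)
exists (Num.max 1 (C + 1)); first by rewrite /= lt_max ltr01.
move=> v /= hv /hC vC; move: hv; apply/negP; rewrite -ltNge lt_max.
by apply/orP; right; rewrite (le_lt_trans vC)// ltrDl.
Qed.

Lemma le_wnorm mu f v : ((mu v * normc (f v))%:E <= wnorm mu f)%E.
Proof. by apply: ereal_sup_ubound; exists v. Qed.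

Lemma wnorm_le mu f (M : \bar R) :
  (forall v, ((mu v * normc (f v))%:E <= M)%E) -> (wnorm mu f <= M)%E.
Proof. by move=> h; apply: ge_ereal_sup => _ [v _ <-]. Qed.

(** The point [o] witnesses that [T] is inhabited, so the supremum is not [-oo]. *)
Lemma Linfty_wnormE o mu f : Linfty mu f -> exists N : R, wnorm mu f = N%:E.
Proof.
move=> foo; exists (fine (wnorm mu f)); rewrite fineK// fin_real// foo andbT.
exact: lt_le_trans (ltNyr _) (le_wnorm mu f o).
Qed.

Section operator.
Variables (o : T) (mu : T -> R) (mu_gt0 : forall v, 0 < mu v).
Variables (psi : T -> R[i]) (phi : T -> T).
Local Notation W := (weighted_comp psi phi).

Let r v := mu v / mu (phi v) * normc (psi v).

Lemma ratio_ge0 v : 0 <= r v.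
Proof. by rewrite mulr_ge0 ?normc_ge0// divr_ge0// ltW. Qed.

Lemma weighted_compE f v :
  mu v * normc (W f v) = r v * (mu (phi v) * normc (f (phi v))).
Proof.
rewrite /weighted_comp normcM /r; have := lt0r_neq0 (mu_gt0 (phi v)).
by move: (mu (phi v)) (normc _) (normc _) => m a b m0; field.
Qed.

Let test : T -> R[i] := fun w => if w \in range phi then (mu w)^-1%:C else 0.

Lemma test_weight w : mu w * normc (test w) = (w \in range phi)%:R.
Proof.
rewrite /test; case: ifP => _; last by rewrite normc0 mulr0.
by rewrite normc_real ?invr_ge0 ?(ltW (mu_gt0 w))// divff// gt_eqF.
Qed.

Lemma wnorm_test_le1 : (wnorm mu test <= 1)%E.
Proof. by apply: wnorm_le => v; rewrite test_weight lee_fin lern1 leq_b1. Qed.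

Lemma L0_test : finite_set (range phi) -> L0 o mu test.
Proof.
move=> fin; split; first exact: le_lt_trans wnorm_test_le1 (ltry _).
(* Points of large length leave the finite set [range phi], so the weighted modulus of [test] is
   eventually 0. *)
apply: cvg_near_cst; apply: filterS (finite_support_at_infinity o fin) => v.
by rewrite test_weight; case: (boolP (v \in _)) => // /set_mem.
Qed.

Lemma weighted_comp_test v : mu v * normc (W test v) = r v.
Proof. by rewrite weighted_compE test_weight mem_set ?mulr1//; exists v. Qed.

Lemma bounded_on_L0_cvg : finite_set (range phi) ->
  bounded_on_L0 o mu W -> r v @[v --> at_infinity o] --> (0 : R).
Proof.
(* Invariance puts [W test] in [L0]; the decay clause of that membership is the convergence of
   [r]. *)
move=> fin [_ /(_ _ (L0_test fin))[_ +] _].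
by under eq_fun do rewrite weighted_comp_test.
Qed.

Lemma cvg_bounded_on_L0 : locally_finite o ->
  r v @[v --> at_infinity o] --> (0 : R) -> bounded_on_L0 o mu W.
Proof.
move=> lfT r0; have [C rC] := cvg_at_infinity_bounded lfT r0.
have C0 : 0 <= C := le_trans (ratio_ge0 o) (rC o).
(* This estimate serves twice: for [W f] having finite weighted norm and for the operator
   inequality. *)
have bound f : (wnorm mu f < +oo)%E -> (wnorm mu (W f) <= C%:E * wnorm mu f)%E.
  move=> /(Linfty_wnormE o)[N fN]; apply: wnorm_le => v.
  rewrite weighted_compE fN -EFinM lee_fin ler_pM ?ratio_ge0//.
    by rewrite mulr_ge0 ?normc_ge0 ?ltW.
  by rewrite -lee_fin -fN le_wnorm.
split.
- by move=> c f g _ _; apply/funext => v; rewrite /weighted_comp mulrDr mulrCA.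
- move=> f [foo _]; have [N fN] := Linfty_wnormE o foo; split.
    by apply: le_lt_trans (bound f foo) _; rewrite fN -EFinM ltry.
  (* The decay of [W f] comes from [r], not from [f]: [phi v] need not go to infinity with [v], so
     the factor at [phi v] is only bounded by the norm [N]. *)
  apply: (@squeeze_cvgr _ _ _ _ (fun=> 0) (fun v => r v * N)).
  + apply: nearW => v; apply/andP; split.
      by rewrite mulr_ge0 ?normc_ge0 ?ltW.
    rewrite weighted_compE ler_wpM2l ?ratio_ge0//.
    by rewrite -lee_fin -fN le_wnorm.
  + exact: cvg_cst.
  + by rewrite -(mul0r N); apply: cvgMl.
- by exists C => f [foo _]; exact: bound.
Qed.

Lemma opnorm_weighted_comp : finite_set (range phi) ->
  opnorm_L0 o mu W = ereal_sup (range (fun v => (r v)%:E)).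
Proof.
move=> fin; apply/le_anti/andP; split.
  apply: ge_ereal_sup => _ [f [_ f1] <-]; apply: wnorm_le => v.
  (* For [f] in the unit ball the factor multiplying [r v] in [weighted_compE] is at most 1. *)
  apply: (@le_trans _ _ (r v)%:E); last by apply: ereal_sup_ubound; exists v.
  rewrite weighted_compE lee_fin ler_piMr ?ratio_ge0//.
  by rewrite -lee_fin (le_trans _ f1)// le_wnorm.
(* The supremum defining the operator norm is attained at [test], where [wnorm mu (W test)] is
   exactly the supremum of [r]. *)
apply: ereal_sup_ubound; exists test.
  by split; [exact: L0_test|exact: wnorm_test_le1].
by rewrite /wnorm; under eq_fun do rewrite weighted_comp_test.
Qed.

End operator.
End weighted.

Unset Implicit Arguments.

Theorem theorem3p4 (R : realType) (T : metricType R) (o : T)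
    (T_locally_finite : locally_finite o) (T_unbounded : unbounded o)
    (mu : T -> R) (mu_gt0 : forall v, 0 < mu v)
    (psi : T -> R[i]) (phi : T -> T) (phi_finite : finite_set (range phi)) :
  (bounded_on_L0 o mu (weighted_comp psi phi) <->
     mu v / mu (phi v) * normc (psi v) @[v --> at_infinity o] --> (0 : R)) /\
  (bounded_on_L0 o mu (weighted_comp psi phi) ->
     opnorm_L0 o mu (weighted_comp psi phi) =
     ereal_sup (range (fun v => (mu v / mu (phi v) * normc (psi v))%:E))).
Proof.
split; last by move=> _; exact: opnorm_weighted_comp.
by split; [exact: bounded_on_L0_cvg|exact: cvg_bounded_on_L0].
Qed.
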